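(* Let $K$ be a field, $n\ge2$, $R=K[x_{ij}:1\le i\le j\le n]$, $X$ the generic symmetric $n\times n$ matrix over $R$, $G$ an undirected simple graph on $[n]$, and $T\subseteq G$ a spanning forest of $G$. Then the $(n-1)$-minors of $X$ form a Gröbner basis of $I_{n-1}(X)$ with respect to the weight order $<_{T,G}$. Equivalently, $\operatorname{in}_{<_{T,G}}(I_{n-1}(X))=I_T$.
   Context: $[n]=\{1,\dots,n\}$; $X=(x_{ij})$ with $x_{ij}:=x_{ji}$ for $i>j$; $I_{n-1}(X)$ is the ideal of $R$ generated by all $(n-1)$-minors of $X$; the (standard) $(n-1)$-minors are $\det(X_{[n]\setminus k,[n]\setminus l})$, $1\le k\le l\le n$. A spanning forest $T\subseteq G$ is the union of one spanning tree for each connected component of $G$. Weights and orders. For a graph $H$ on $[n]$, $w_H$ is the weight vector with $w_H(x_{ii})=2$ for all $i$, $w_H(x_{ij})=2$ for edges $ij\in H$, and $w_H(x_{ij})=1$ for $i<j$, $ij\notin H$. $w_{\mathrm{diag}}$ is $w_H$ for $H$ without edges. The (partial) weight order $<_{T,G}$ compares two monomials first by $w_G$-degree, then, if these are equal, by $w_T$-degree, and then, if these are equal as well, by $w_{\mathrm{diag}}$-degree. It is not a total order. For $0\ne f\in R$, $\operatorname{in}_{<_{T,G}}(f)$ is the sum of all terms of $f$ whose monomials are maximal for this comparison; $\operatorname{in}_{<_{T,G}}(J)$ is the ideal generated by the initial forms of all nonzero elements of $J$; elements of $J$ form a Gröbner basis if their initial forms generate $\operatorname{in}_{<_{T,G}}(J)$.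 Ideal $I_T$. Paths have no repeated vertices and contain at least one edge; for a path $p$, $V(p)$ is its vertex set and $x_p:=\prod_{ij\in p}x_{ij}$ is the product over its edges. $I_T\subseteq R$ is generated by the monomials - $\frac{x_{11}\cdots x_{nn}}{x_{ii}}$ for all $i=1,\dots,n$; - $\frac{x_{11}\cdots x_{nn}}{x_{kk}x_{ll}}x_{kl}$ for all $1\le k<l\le n$ such that there is no path in $T$ between $k$ and $l$; - $\left(\prod_{i\in[n]\setminus V(p)}x_{ii}\right)\cdot x_p$ for all paths $p$ in $T$. *)

(* Defs.v *)
From HB Require Import structures.
From mathcomp Require Import all_boot all_order all_algebra.
From mathcomp Require Import mpoly.

Set Implicit Arguments.
Unset Strict Implicit.
Unset Printing Implicit Defensive.

Import GRing.Theory.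
Local Open Scope ring_scope.

(* Vertices are 0, ..., n-1, i.e. 'I_n; a graph is its adjacency relation. *)
Section Graphs.
Variable n : nat.
Implicit Types (e G T : rel 'I_n) (C : {set 'I_n}).

Definition simple_graph e : Prop := ssrbool.symmetric e /\ irreflexive e.

(* In a simple graph, a repetition-free closed walk with at most two vertices
   is empty or runs back and forth along one edge; it is not a cycle. *)
Definition acyclic e : Prop := forall c : seq 'I_n, ucycle e c -> (size c < 3)%N.

Definition components G : {set {set 'I_n}} :=
  equivalence_partition (connect G) [set: 'I_n].

(* e is a tree with vertex set C, all of whose edges are edges of G *)
Definition spanning_tree e G C : Prop :=
  [/\ simple_graph e,
      forall x y, e x y -> [&& G x y, x \in C & y \in C],
      {in C &, forall x y, connect e x y}
    & acyclic e].

Definition spanning_forest T G : Prop :=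
  exists S : {set 'I_n} -> rel 'I_n,
    {in components G, forall C, spanning_tree (S C) G C} /\
    (forall x y, T x y = [exists C in components G, S C x y]).

(* the path with successive vertices k :: p, with at least one edge *)
Definition simple_path e (k : 'I_n) (p : seq 'I_n) : bool :=
  [&& p != [::], path e k p & uniq (k :: p)].

End Graphs.

Section Ideals.
Variable R : comNzRingType.
Implicit Types S : R -> Prop.

Definition ideal_gen S : R -> Prop := fun f =>
  exists s : seq (R * R),
    (forall c, c \in s -> S c.2) /\ f = \sum_(c <- s) c.1 * c.2.

End Ideals.

Section InitialForms.
Variables (K : fieldType) (N : nat).
Implicit Types (lt : rel 'X_{1..N}) (J B : {mpoly K[N]} -> Prop).

Definition wdeg (w : 'I_N -> nat) (m : 'X_{1..N}) : nat :=
  (\sum_(v < N) w v * m v)%N.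

(* comparison by w1-degree, then w2-degree, then w3-degree *)
Definition weight_lt (w1 w2 w3 : 'I_N -> nat) : rel 'X_{1..N} := fun m m' =>
  (wdeg w1 m < wdeg w1 m')%N ||
  (wdeg w1 m == wdeg w1 m') &&
    ((wdeg w2 m < wdeg w2 m')%N ||
     (wdeg w2 m == wdeg w2 m') && (wdeg w3 m < wdeg w3 m')%N).

(* For a partial order this need not be a single term; it is 0 at f = 0. *)
Definition initial_form lt (f : {mpoly K[N]}) : {mpoly K[N]} :=
  \sum_(m <- msupp f | all (fun m' => ~~ lt m m') (msupp f)) f@_m *: 'X_[m].

Definition initial_ideal lt J : {mpoly K[N]} -> Prop :=
  ideal_gen (fun h => exists f, [/\ J f, f != 0 & h = initial_form lt f]).

Definition groebner_basis lt B J : Prop :=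
  (forall g, B g -> J g) /\
  (forall f, ideal_gen (fun h => exists g, B g /\ h = initial_form lt g) f <->
             initial_ideal lt J f).

End InitialForms.

Section GenericSymmetric.
Variables (K : fieldType) (n : nat).

(* The variables x_ij, i <= j, are numbered by enumerating these pairs. *)
Definition upper_pair : finType := {p : 'I_n * 'I_n | (p.1 <= p.2)%N}.
Definition nvars : nat := #|upper_pair|.

Definition sort_pair (i j : 'I_n) : 'I_n * 'I_n :=
  if (i <= j)%N then (i, j) else (j, i).

Lemma sort_pairP i j : ((sort_pair i j).1 <= (sort_pair i j).2)%N.
Proof. by rewrite /sort_pair; case: (leqP i j) => [|/ltnW]. Qed.

Definition var_index (i j : 'I_n) : 'I_nvars :=
  enum_rank (exist _ (sort_pair i j) (sort_pairP i j) : upper_pair).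

Local Notation polyR := {mpoly K[nvars]}.

Definition xvar (i j : 'I_n) : polyR := 'X_(var_index i j).

Definition genX : 'M[polyR]_n := \matrix_(i < n, j < n) xvar i j.

Definition minor (k l : 'I_n) : polyR := \det (row' k (col' l genX)).

Definition standard_minor (f : polyR) : Prop :=
  exists k l : 'I_n, (k <= l)%N /\ f = minor k l.

(* all (n-1)-minors arise by deleting one row and one column *)
Definition minors_ideal : polyR -> Prop :=
  ideal_gen (fun f => exists k l : 'I_n, f = minor k l).

Definition graph_weight (H : rel 'I_n) (v : 'I_nvars) : nat :=
  let p := val (enum_val v) in if (p.1 == p.2) || H p.1 p.2 then 2 else 1.

Definition diag_weight : 'I_nvars -> nat := graph_weight (fun _ _ => false).

(* The G-weight is compared first, despite the argument order. *)
Definition forest_lt (T G : rel 'I_n) : rel 'X_{1..nvars} :=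
  weight_lt (graph_weight G) (graph_weight T) diag_weight.

(* x_p for the path with successive vertices k :: p *)
Definition path_monomial (k : 'I_n) (p : seq 'I_n) : polyR :=
  \prod_(y <- pairmap xvar k p) y.

Variant IT_generator (T : rel 'I_n) : polyR -> Prop :=
| IT_diag (i : 'I_n) :
    IT_generator T (\prod_(j < n | j != i) xvar j j)
| IT_disconnected (k l : 'I_n) of (k < l)%N
    & ~ (exists p, simple_path T k p /\ last k p = l) :
    IT_generator T ((\prod_(j < n | (j != k) && (j != l)) xvar j j) * xvar k l)
| IT_path (k : 'I_n) (p : seq 'I_n) of simple_path T k p :
    IT_generator T ((\prod_(i < n | i \notin k :: p) xvar i i)
                      * path_monomial k p).

Definition IT (T : rel 'I_n) : polyR -> Prop := ideal_gen (IT_generator T).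

End GenericSymmetric.

(* Main.v *)
Require Import Defs.
From mathcomp Require Import all_boot all_order all_algebra all_fingroup.
From mathcomp Require Import zify.
From mathcomp Require Import mpoly.

(* The relations X adj(X) = det(X) are linear syzygies between the
   (n-1)-minors A_kl. Call route(k, l) the path in T from k to l, or the single
   edge kl if there is none; it is the unique shortest path from k to l in the
   complete graph when edges get lexicographic lengths (not in G, not in T, 1).
   The leading monomial of A_kl is x_route(k, l) times the x_ii with i off the
   route, and if j follows k on route(k, l), the leading part of
   sum_j x_kj A_jl = 0 is the binomial syzygy between x_kk A_kl and x_kj A_jl.
   These binomial syzygies connect any two leading monomials that divide a given
   monomial M: both ends of a route may be moved inwards past the vertices i with
   x_ii | M, and the final position is determined by the set of i with
   x_ii not dividing M. Hence one multiple of a minor for each monomial of I_T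
   spans I_(n-1)(X), and the leading monomials of this family are distinct. *)

Set Implicit Arguments.
Unset Strict Implicit.
Unset Printing Implicit Defensive.

Import GRing.Theory.
Local Open Scope ring_scope.

(** * Spanning forests: edges, connectivity, acyclicity *)

Section SpanningForest.
Variables (n : nat) (G T : rel 'I_n).
Hypotheses (hG : simple_graph G) (hT : spanning_forest T G).

Let connect_equiv : {in [set: 'I_n] & &, equivalence_rel (connect G)}.
Proof.
have sG : connect_sym G by apply: sym_connect_sym; case: hG.
move=> x y z _ _ _; split=> [|xy]; first exact: connect0.
by apply/idP/idP; apply: connect_trans => //; rewrite sG.
Qed.

Let partition_components : partition (components G) [set: 'I_n].
Proof. exact: equivalence_partitionP. Qed.

Let component x := pblock (components G) x.

Let cover_components x : x \in cover (components G).
Proof. by rewrite (cover_partition partition_components) inE. Qed.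

Let component_in x : component x \in components G.
Proof. exact: pblock_mem. Qed.

Let mem_component x : x \in component x.
Proof. by rewrite mem_pblock. Qed.

Let component_uniq C x : C \in components G -> x \in C -> C = component x.
Proof.
case/and3P: partition_components => _ tI _ CG xC.
by rewrite /component (def_pblock tI CG xC).
Qed.

Lemma spanning_forest_subrel : subrel T G.
Proof.
case: hT => S [SP TE] x y; rewrite TE => /existsP[C /andP[CG SC]].
by case: (SP C CG) => _ /(_ x y SC)/and3P[].
Qed.

Lemma spanning_forest_sym : ssrbool.symmetric T.
Proof.
case: hT => S [SP TE] x y; rewrite !TE.
apply: eq_existsb => C; case CG: (_ \in _) => //=.
by case: (SP C CG) => -[].
Qed.

Lemma spanning_forest_irr : irreflexive T.
Proof.
move=> x; apply/negP=> /spanning_forest_subrel.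
by case: hG => _ ->.
Qed.

(** Adjacent vertices of [G] share a component, whose spanning tree joins them. Contrapositively, a
    pair not joined in [T] is no edge of [G], which fixes its cost below. *)
Lemma spanning_forest_connect x y : G x y -> connect T x y.
Proof.
move=> Gxy; case: hT => S [SP TE].
have yC : y \in component x.
  rewrite /component (@pblock_equivalence_partition _ _ setT) ?inE //.
  exact: connect1.
case: (SP _ (component_in x)) => _ _ /(_ x y (mem_component x) yC) cxy _.
apply: connect_sub cxy => u v Suv; apply: connect1; rewrite TE.
by apply/existsP; exists (component x); rewrite component_in.
Qed.

(** A walk in [T] cannot leave the component of its first vertex, because each edge of [T] belongs
    to the tree of a component containing both its ends. So a cycle of [T] would be a cycle of one
    tree. *)
Lemma spanning_forest_acyclic : acyclic T.
Proof.
case: hT => S [SP TE] [//|x c] /andP[cyc uc].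
case: (SP _ (component_in x)) => _ _ _ acycS; apply: acycS.
rewrite /ucycle uc andbT.
have step u v : u \in component x -> T u v ->
    S (component x) u v && (v \in component x).
  move=> uC; rewrite TE => /existsP[C /andP[CG SC]].
  have [_ /(_ u v SC)/and3P[_ uC' vC'] _ _] := SP C CG.
  have CE : C = component x.
    by rewrite (component_uniq CG uC') (component_uniq (component_in x) uC).
  by rewrite -CE SC.
suff H p u : u \in component x -> path T u p -> path (S (component x)) u p.
  exact: H (mem_component x) cyc.
elim: p u => //= v p IHp u uC /andP[/(step _ _ uC)/andP[-> vC]].
exact: IHp.
Qed.

End SpanningForest.

(** * Unique tree paths and routes *)

Section TreePaths.
Variables (n : nat) (T : rel 'I_n).
Hypotheses (symT : ssrbool.symmetric T) (irrT : irreflexive T)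
  (acycT : acyclic T).

Definition tree_path k l p := [&& path T k p, uniq (k :: p) & last k p == l].

Lemma tree_path_ex k l : connect T k l -> exists p, tree_path k l p.
Proof.
case/connectP=> p /shortenP[q pq uq _] ->.
by exists q; rewrite /tree_path pq uq eqxx.
Qed.

(** The edge from [a] back to [k] closes the path to a repetition-free closed walk, which by
    acyclicity has at most two vertices. *)
Lemma tree_path_edge k a p : T k a -> tree_path k a p -> p = [:: a].
Proof.
move=> Tka /and3P[pp up /eqP lp].
have /acycT : ucycle T (k :: p).
  by rewrite /ucycle up andbT /= rcons_path pp lp symT.
case: p pp up lp => [_ _ /= ka|b [|c p] //= _ _ -> //].
by move: Tka; rewrite -ka irrT.
Qed.

(* Were the first steps a, b distinct, the two paths would join them in T
   minus k, giving a cycle through k. *)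
Lemma tree_path_head k l a b p q :
  tree_path k l (a :: p) -> tree_path k l (b :: q) -> a = b.
Proof.
move=> /and3P[/= /andP[Tka pa] /andP[ka _] /eqP la].
move=> /and3P[/= /andP[Tkb pb] /andP[kb _] /eqP lb].
pose T' := [rel x y | [&& T x y, x != k & y != k]].
have sT' : connect_sym T'.
  by apply: sym_connect_sym => x y; rewrite /= symT [(x != k) && _]andbC.
have sub x s : path T x s -> k \notin x :: s -> connect T' x (last x s).
  elim: s x => //= y s IHs x /andP[Txy ps]; rewrite !inE !negb_or.
  move=> /and3P[kx ky ks]; apply: (@connect_trans _ _ y).
    by apply: connect1; rewrite /= Txy eq_sym kx eq_sym ky.
  by apply: IHs => //; rewrite inE negb_or ky.
have cba : connect T' b a.
  apply: (@connect_trans _ _ l); first by rewrite -lb sub.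
  by rewrite sT' -la sub.
case/connectP: cba => s /shortenP[r pr ur _] lr.
have kr : k \notin r.
  elim: r b pr {ur lr kb pb Tkb lb} => //= y r IHr b.
  by case/andP=> /and3P[_ _ ky] /IHr; rewrite inE eq_sym negb_or ky.
have kb' : k != b by move: kb; rewrite inE negb_or => /andP[].
have : tree_path k a (b :: r).
  rewrite /tree_path /= Tkb inE negb_or kb' kr -lr eqxx andbT /=.
  by move: ur => /= ->; rewrite andbT (sub_path _ pr) // => x y /andP[].
by move/(tree_path_edge Tka) => [->].
Qed.

Lemma tree_path_behead k l a p : tree_path k l (a :: p) -> tree_path a l p.
Proof. by case/and3P=> /= /andP[_ pp] /andP[_ up] lp; apply/and3P. Qed.

Lemma tree_path_uniq k l p q : tree_path k l p -> tree_path k l q -> p = q.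
Proof.
elim: p k q => [|a p IHp] k [|b q] //.
- move=> /and3P[_ _ /eqP /= <-] /and3P[_ /= /andP[kq _] /eqP lq].
  by have := mem_last b q; rewrite lq (negbTE kq).
- move=> /and3P[_ /= /andP[kp _] /eqP lp] /and3P[_ _ /eqP /= kl].
  by have := mem_last a p; rewrite lp -kl (negbTE kp).
move=> tp tq; have ab := tree_path_head tp tq; rewrite -ab in tq *.
by rewrite (IHp _ _ (tree_path_behead tp) (tree_path_behead tq)).
Qed.

Definition route_to k l p :=
  if connect T k l then tree_path k l p else p == [:: l].

Lemma route_to_ex k l : exists p, route_to k l p.
Proof.
rewrite /route_to; case: (connect T k l) / boolP => [/tree_path_ex //|_].
by exists [:: l].
Qed.

(** Only the vertices after [k] are listed, so the route is empty for [k = l] and [[:: l]] for a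
    jump between components. *)
Definition route k l : seq 'I_n := xchoose (route_to_ex k l).

Lemma routeP k l : route_to k l (route k l).
Proof. exact: xchooseP. Qed.

Lemma route_tree k l p : tree_path k l p -> route k l = p.
Proof.
move=> tp; apply: (tree_path_uniq _ tp); have := routeP k l; rewrite /route_to.
case: (connect T k l) / boolP => // /negP[]; case/and3P: tp => pp _ /eqP lp.
by apply/connectP; exists p.
Qed.

Lemma route_disconnected k l : ~~ connect T k l -> route k l = [:: l].
Proof.
by have := routeP k l; rewrite /route_to => + /negbTE nc; rewrite nc => /eqP.
Qed.

Lemma route_connected k l : connect T k l -> tree_path k l (route k l).
Proof. by have := routeP k l; rewrite /route_to => + ckl; rewrite ckl. Qed.

Lemma route_refl k : route k k = [::].
Proof. by apply: route_tree; rewrite /tree_path /= eqxx. Qed.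

Lemma route_uniq k l : k != l -> uniq (k :: route k l).
Proof.
have [/route_connected/and3P[] //|nc kl] := boolP (connect T k l).
by rewrite route_disconnected //= inE kl.
Qed.

Lemma last_route k l : last k (route k l) = l.
Proof.
have [/route_connected/and3P[_ _ /eqP//]|nc] := boolP (connect T k l).
by rewrite route_disconnected.
Qed.

Lemma route_step k l : k != l -> exists j, k != j /\ route k l = j :: route j l.
Proof.
move=> kl; have [ckl|nc] := boolP (connect T k l).
  move: (route_connected ckl) (last_route k l).
  case: (route k l) => [_ /= e|j p tp _]; first by rewrite e eqxx in kl.
  exists j; split; last by rewrite (route_tree (tree_path_behead tp)).
  by case/and3P: tp => _ /= /andP[]; rewrite inE negb_or => /andP[].
by exists l; rewrite kl route_disconnected // route_refl.
Qed.

(** If the path to [l] visits [j], its part up to [j] can only be the edge [kj]. Otherwise, going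
    from [j] to [k] and then along the path repeats no vertex. *)
Lemma route_edge k j l : T k j -> connect T k l -> k != l ->
  route k l = j :: route j l \/ route j l = k :: route k l.
Proof.
move=> Tkj ckl kl; have tp := route_connected ckl.
have [jp|jp] := boolP (j \in route k l).
  left; case/splitPr: jp (tp) => p1 p2 tp'.
  have e : tree_path k j (rcons p1 j).
    case/and3P: tp' => pp up _; apply/and3P; split; last by rewrite last_rcons.
      by move: pp; rewrite -cat_rcons cat_path => /andP[].
    by move: up; rewrite -cat_rcons -cat_cons cat_uniq => /andP[].
  have := tree_path_edge Tkj e; case: p1 e tp' => [|? []] //= _ tp' _.
  by rewrite (route_tree (tree_path_behead tp')).
right; apply: route_tree; case/and3P: tp => pp up lp.
apply/and3P; split=> //=; first by rewrite symT Tkj.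
have jk : j != k by apply: contraTneq Tkj => ->; rewrite irrT.
by move: up => /= ->; rewrite inE negb_or jk jp.
Qed.

End TreePaths.

(** * Indices of the matrix variables *)

Section VarIndex.
Variable n : nat.
Implicit Types i j k l : 'I_n.

Lemma sort_pairC i j : sort_pair i j = sort_pair j i.
Proof.
by rewrite /sort_pair; case: (ltngtP i j) => // /val_inj ->.
Qed.

Lemma var_indexC i j : var_index i j = var_index j i.
Proof. by congr enum_rank; apply: val_inj; rewrite /= sort_pairC. Qed.

Lemma var_index_diag i j k : var_index i j = var_index k k -> i = k /\ j = k.
Proof.
move/enum_rank_inj/(congr1 val); rewrite /= /sort_pair leqnn.
by case: ifP => _ [-> ->].
Qed.

Lemma graph_weight_var (H : rel 'I_n) i j : ssrbool.symmetric H ->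
  graph_weight H (var_index i j) = if (i == j) || H i j then 2 else 1.
Proof.
move=> symH; rewrite /graph_weight enum_rankK /= /sort_pair.
by case: (i <= j)%N => //=; rewrite symH eq_sym.
Qed.

End VarIndex.

(** * Edge costs and cheapest routes *)

Section Distance.
Variables (n : nat) (G T : rel 'I_n).
Hypotheses (hG : simple_graph G) (hT : spanning_forest T G).
Implicit Types i j k l : 'I_n.

Let symG : ssrbool.symmetric G := proj1 hG.
Let symT := spanning_forest_sym hT.
Let irrT := spanning_forest_irr hG hT.
Let acycT := spanning_forest_acyclic hG hT.
Let P := route T.

(* Exceeds every weighted degree of a monomial of degree at most n. *)
Definition base := (2 * n).+1.

(** The loss of weight of [x_ij] against a diagonal variable, so that heavy monomials correspond to
    cheap sets of edges. The summand 1 is the loss in [diag_weight]. *)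
Definition edge_cost i j : nat :=
  if i == j then 0 else (1 + base * ~~ T i j + base ^ 2 * ~~ G i j)%N.

(* A lexicographic comparison of the three weights, packed in one number. *)
Definition combined_weight (v : 'I_(nvars n)) : nat :=
  (base ^ 2 * graph_weight G v + base * graph_weight T v + diag_weight v)%N.

Definition max_weight : nat := (2 * (base ^ 2 + base + 1))%N.

(** The cost of the route: 1 for each tree edge, or the cost of one pair outside both [T] and [G]
    for a jump between components. *)
Definition dist k l : nat :=
  if connect T k l then size (P k l) else (1 + base + base ^ 2)%N.

Lemma combined_weight_var i j :
  (combined_weight (var_index i j) + edge_cost i j = max_weight)%N.
Proof.
rewrite /combined_weight /diag_weight !graph_weight_var //.
rewrite /edge_cost /max_weight; case: eqP => [_|_] /=; first by lia.
have [Tij|_] := boolP (T i j).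
  by rewrite (spanning_forest_subrel hT Tij) /=; lia.
by case: (G i j) => /=; lia.
Qed.

Lemma edge_cost_sym i j : edge_cost i j = edge_cost j i.
Proof. by rewrite /edge_cost eq_sym symT symG. Qed.

Lemma edge_cost_eq0 i j : (edge_cost i j == 0%N) = (i == j).
Proof. by rewrite /edge_cost; case: ifP. Qed.

Lemma size_route_lt k l : (size (P k l) < n)%N.
Proof.
have [<-|kl] := eqVneq k l; last first.
  have := max_card (mem (k :: P k l)).
  by rewrite card_ord (card_uniqP (route_uniq T kl)).
by rewrite /P route_refl //=; case: (k) => m; lia.
Qed.

Lemma dist_refl k : dist k k = 0%N.
Proof. by rewrite /dist connect0 /P route_refl. Qed.

Lemma edge_cost_disconnected i j :
  ~~ connect T i j -> edge_cost i j = (1 + base + base ^ 2)%N.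
Proof.
move=> nc; rewrite /edge_cost.
have -> : i == j = false by apply: contraNF nc => /eqP ->; apply: connect0.
have -> : T i j = false by apply: contraNF nc; apply: connect1.
have -> : G i j = false.
  by apply: contraNF nc; apply: spanning_forest_connect hG hT _ _.
by rewrite !muln1.
Qed.

Lemma edge_cost_tree i j : T i j -> edge_cost i j = 1%N.
Proof.
move=> Tij; rewrite /edge_cost Tij (spanning_forest_subrel hT Tij) !muln0.
by case: eqP Tij => // ->; rewrite irrT.
Qed.

Lemma dist_step k l j :
  P k l = j :: P j l -> dist k l = (edge_cost k j + dist j l)%N.
Proof.
rewrite /dist; have [ckl|nkl] := boolP (connect T k l).
  move=> E; have := route_connected ckl; rewrite -/P E => /and3P[/andP[Tkj _] _ _].
  have -> : connect T j l.
    by rewrite (same_connect (sym_connect_sym symT) (connect1 Tkj)) in ckl.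
  by rewrite edge_cost_tree //= add1n.
rewrite {1}/P route_disconnected // => -[<- _].
by rewrite connect0 edge_cost_disconnected // /P route_refl // addn0.
Qed.

(** The strict inequality is what makes leading terms unique. Inside a component, a step off [T]
    costs more than any tree path, and a tree step off the route leads away from [l]. Across
    components, either [kj] is itself a jump and [j] is not yet [l], or the jump is still to be paid
    after [j]. *)
Lemma dist_lt_detour k l j : k != l -> j != k ->
  P k l = j :: P j l \/ (dist k l < edge_cost k j + dist j l)%N.
Proof.
move=> kl jk; have jk' : k == j = false by rewrite eq_sym (negbTE jk).
rewrite {1}/dist; have [ckl|nkl] := boolP (connect T k l).
  have [Tkj|nT] := boolP (T k j); last first.
    by right; have := size_route_lt k l; rewrite /edge_cost jk' nT /base; lia.
  have cjl : connect T j l.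
    by rewrite (same_connect (sym_connect_sym symT) (connect1 Tkj)) in ckl.
  rewrite edge_cost_tree // /dist cjl.
  case: (route_edge symT irrT acycT Tkj ckl kl) => E; first by left.
  by right; rewrite /P E /=; lia.
have [-> | jl] := eqVneq j l.
  by left; rewrite /P route_disconnected // route_refl.
right; rewrite /dist; have [cjl|njl] := boolP (connect T j l).
  have nkj : ~~ connect T k j.
    by apply: contra nkl => ckj; apply: connect_trans ckj cjl.
  rewrite edge_cost_disconnected //.
  rewrite /P.
  case: (route T j l) (last_route T j l) => [/= e|x p _ /=]; last by lia.
  by rewrite e eqxx in jl.
by have := edge_cost_eq0 k j; rewrite jk'; lia.
Qed.

Lemma dist_triangle k l j : (dist k l <= edge_cost k j + dist j l)%N.
Proof.
have [<-|kl] := eqVneq k l; first by rewrite dist_refl.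
have [->|jk] := eqVneq j k; first by rewrite leq_addl.
by case: (dist_lt_detour kl jk) => [/dist_step ->|/ltnW].
Qed.

End Distance.

(** * Additivity of weighted degrees *)

Section WeightedDegree.
Variables (N : nat) (w : 'I_N -> nat).
Implicit Types m : 'X_{1..N}.

Lemma wdegD m1 m2 : wdeg w (m1 + m2)%MM = (wdeg w m1 + wdeg w m2)%N.
Proof.
by rewrite /wdeg -big_split /=; apply: eq_bigr => v _; rewrite mnmDE mulnDr.
Qed.

Lemma wdegU v : wdeg w U_(v)%MM = w v.
Proof.
rewrite /wdeg (bigD1 v) //= mnm1E eqxx muln1 big1 ?addn0 // => u uv.
by rewrite mnm1E eq_sym (negbTE uv) muln0.
Qed.

Lemma wdeg0 : wdeg w 0%MM = 0%N.
Proof. by rewrite /wdeg big1 // => v _; rewrite mnm0E muln0. Qed.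

Lemma wdeg_sum (I : Type) (r : seq I) (Q : pred I) (F : I -> 'X_{1..N}) :
  wdeg w (\sum_(i <- r | Q i) F i)%MM = (\sum_(i <- r | Q i) wdeg w (F i))%N.
Proof. exact: (big_morph _ wdegD wdeg0). Qed.

Lemma wdeg_le c m : (forall v, w v <= c)%N -> (wdeg w m <= c * mdeg m)%N.
Proof.
move=> wc; rewrite /wdeg mdegE big_distrr /=.
by apply: leq_sum => v _; rewrite leq_mul2r wc orbT.
Qed.

End WeightedDegree.

(** * Route monomials and their vertex sets *)

Section RouteMonomials.
Variables (n : nat) (T : rel 'I_n).
Hypotheses (symT : ssrbool.symmetric T) (irrT : irreflexive T)
  (acycT : acyclic T).
Implicit Types i j k l : 'I_n.

Definition route_monomial k l : 'X_{1..nvars n} :=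
  (\sum_(i | i \notin k :: route T k l) U_(var_index i i) +
   \sum_(v <- pairmap (@var_index n) k (route T k l)) U_(v))%MM.

Definition route_verts k l : {set 'I_n} := [set i in k :: route T k l].

Lemma route_monomial_refl k :
  route_monomial k k = (\sum_(i | i != k) U_(var_index i i))%MM.
Proof.
rewrite /route_monomial route_refl //= big_nil addm0.
by apply: eq_bigl => i; rewrite inE.
Qed.

Lemma route_notin k l : k \notin route T k l.
Proof.
have [<-|/(route_uniq T)/andP[]//] := eqVneq k l.
by rewrite route_refl.
Qed.

(** Dropping the first edge of the route takes [k] off it, so [x_kk] replaces [x_kj]. This is the
    binomial syzygy on the level of monomials. *)
Lemma route_monomial_step k l j : route T k l = j :: route T j l ->
  (U_(var_index k k) + route_monomial k l =
   U_(var_index k j) + route_monomial j l)%MM.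
Proof.
move=> E; have := route_notin k l; rewrite /route_monomial E /= => kj.
rewrite big_cons [in RHS](bigD1 k) //=.
rewrite (eq_bigl (fun i => (i \notin j :: route T j l) && (i != k))); last first.
  by move=> i; rewrite [in LHS]inE negb_or andbC.
by apply/mnmP=> v; rewrite !mnmDE [RHS]addnCA -[RHS]addnA.
Qed.

(** Induction along the route with its target fixed; the tail of a route is the route from its next
    vertex. *)
Lemma route_ind (Q : 'I_n -> 'I_n -> Prop) :
  (forall k, Q k k) ->
  (forall k l j, k != l -> k != j -> route T k l = j :: route T j l ->
     Q j l -> Q k l) ->
  forall k l, Q k l.
Proof.
move=> Q0 QS k l; elim: {k}_.+1 {-2}k (ltnSn (size (route T k l))) => // s IHs k.
rewrite ltnS => le_s; have [<-//|kl] := eqVneq k l.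
have [j [kj E]] := route_step symT irrT acycT kl.
by apply: (QS _ _ _ kl kj E); apply: IHs; rewrite E in le_s.
Qed.

(** The vertices of a route can thus be read off its monomial. This ties divisibility of a monomial
    [M] to the position of the ends, and carries symmetry over from monomials to vertex sets. *)
Lemma route_monomial_diag k l i :
  route_monomial k l (var_index i i) = (i \notin route_verts k l).
Proof.
rewrite inE; move: k l; apply: route_ind => [k|k l j kl kj E IH].
  rewrite route_monomial_refl route_refl // inE mnm_sumE.
  have [->|ik] := eqVneq i k.
    rewrite big1 // => j jk; rewrite mnm1E; case: eqP => // /var_index_diag[].
    by move/eqP; rewrite (negbTE jk).
  rewrite (bigD1 i) //= mnm1E eqxx big1 // => j /andP[_ ji].
  by rewrite mnm1E; case: eqP => // /var_index_diag[] /eqP; rewrite (negbTE ji).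
move: (route_monomial_step E) IH.
move: (route_monomial k l) (route_monomial j l) => a b.
move=> /mnmP/(_ (var_index i i)); rewrite !mnmDE !mnm1E => + IH; rewrite IH.
have -> : var_index k j == var_index i i = false.
  by apply: contraNF kj => /eqP/var_index_diag[-> ->].
have -> : var_index k k == var_index i i = (i == k).
  by apply/eqP/eqP => [/var_index_diag[]|->].
have := route_notin k l; rewrite E [i \in k :: _]in_cons negb_or.
have [->|_] := eqVneq i k; first by move=> -> /=; lia.
by move=> _ /=; lia.
Qed.

Lemma mem_route_verts k l : (k \in route_verts k l) * (l \in route_verts k l).
Proof.
have := mem_last k (route T k l); rewrite last_route => ml.
by split; rewrite inE // mem_head.
Qed.

Lemma route_verts_refl k : route_verts k k = [set k].
Proof. by apply/setP=> i; rewrite !inE route_refl // in_nil orbF. Qed.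

Lemma route_verts_step k l j : route T k l = j :: route T j l ->
  route_verts k l = k |: route_verts j l /\ k \notin route_verts j l.
Proof.
move=> E; have := route_notin k l; rewrite E => kj.
by split; [apply/setP=> i; rewrite !inE E | rewrite inE].
Qed.

(** The route from [u] is a tail of the route from [k], and a route never returns to its first
    vertex. *)
Lemma route_verts_suffix k l u : u \in route_verts k l ->
  route_verts u l \subset route_verts k l /\
  (u != k -> k \notin route_verts u l).
Proof.
move: k l u; apply: route_ind => [k|k l j kl kj E IH] u.
  by rewrite route_verts_refl inE => /eqP ->; rewrite route_verts_refl eqxx.
have [VE kV] := route_verts_step E; have [->|uk] := eqVneq u k; first by [].
rewrite VE !in_setU1 (negbTE uk) /= => /IH[sub _].
split=> [|_]; first exact: subset_trans sub (subsetUr _ _).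
by apply: contra kV; apply: (subsetP sub).
Qed.

Lemma route_verts_total k l u v : u \in route_verts k l -> v \in route_verts k l ->
  v \in route_verts u l \/ u \in route_verts v l.
Proof.
move: k l u v; apply: route_ind => [k|k l j kl kj E IH] u v.
  by rewrite route_verts_refl !in_set1 => /eqP -> /eqP ->; left; rewrite mem_route_verts.
have [VE _] := route_verts_step E.
have [-> _ vV|uk] := eqVneq u k; first by left.
have [-> uV _|vk] := eqVneq v k; first by right.
by rewrite VE !in_setU1 (negbTE uk) (negbTE vk) /=; apply: IH.
Qed.

End RouteMonomials.

(** * Leading terms of the cofactors *)

Section LeadingTerms.
Variables (K : fieldType) (n : nat) (G T : rel 'I_n).
Hypotheses (hG : simple_graph G) (hT : spanning_forest T G).
Implicit Types i j k l : 'I_n.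

Let symT := spanning_forest_sym hT.
Let irrT := spanning_forest_irr hG hT.
Let acycT := spanning_forest_acyclic hG hT.
Let w := combined_weight G T.
Let lead := route_monomial T.
(** Cofactors carry the signs of the minors, so the row relations have the plain coefficients
    [x_kj]. *)
Let A k l : {mpoly K[nvars n]} := cofactor (genX K n) k l.

Definition perm_monomial (s : 'S_n) k : 'X_{1..nvars n} :=
  (\sum_(i | i != k) U_(var_index i (s i)))%MM.

Lemma cofactor_permE k l :
  A k l = \sum_(s : 'S_n | s k == l) (-1) ^+ s *: 'X_[perm_monomial s k].
Proof.
rewrite /A expand_cofactor; apply: eq_bigr => s _.
rewrite -mul_mpolyC rmorphXn /= mpolyCN mpolyC1; congr (_ * _).
rewrite /perm_monomial -mprodXE; apply: eq_big => i; first by rewrite eq_sym.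
by rewrite mxE.
Qed.

Lemma cofactor_msupp k l m : m \in msupp (A k l) ->
  exists2 s : 'S_n, s k = l & m = perm_monomial s k.
Proof.
rewrite cofactor_permE => /msupp_sum_le/flattenP[r /mapP[s]].
rewrite mem_filter => /andP[/eqP skl _] -> /msuppZ_le.
by rewrite msuppX inE => /eqP ->; exists s.
Qed.

Lemma mdeg_cofactor k l m : m \in msupp (A k l) -> mdeg m = n.-1.
Proof.
case/cofactor_msupp=> s _ ->; rewrite /perm_monomial mdeg_sum.
rewrite (eq_bigr (fun=> 1%N)) => [|i _]; last by rewrite mdeg1.
by rewrite sum1_card cardC1 card_ord.
Qed.

Lemma tr_genX : (genX K n)^T = genX K n.
Proof. by apply/matrixP=> i j; rewrite !mxE /xvar var_indexC. Qed.

Lemma genX_cofactor_row k l :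
  \sum_j xvar K k j * A j l = (\det (genX K n)) *+ (k == l).
Proof.
transitivity ((genX K n *m \adj (genX K n)) k l); last by rewrite mul_mx_adj mxE.
rewrite mxE; apply: eq_bigr => j _; rewrite [genX K n k j]mxE; congr (_ * _).
by rewrite [RHS]mxE /A -[in LHS]tr_genX cofactor_tr.
Qed.

Lemma cofactorC k l : A k l = A l k.
Proof.
by rewrite /A -[in LHS]tr_genX cofactor_tr.
Qed.

Lemma wdeg_perm_monomial (s : 'S_n) k :
  (wdeg w (perm_monomial s k) + \sum_(i | i != k) edge_cost G T i (s i)
   = n.-1 * max_weight n)%N.
Proof.
rewrite /perm_monomial wdeg_sum -big_split /=.
rewrite (eq_bigr (fun=> max_weight n)) => [|i _].
  by rewrite sum_nat_const cardC1 card_ord.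
by rewrite wdegU combined_weight_var.
Qed.

Lemma wdeg_route_step k l j : route T k l = j :: route T j l ->
  (w (var_index k k) + wdeg w (lead k l) =
   w (var_index k j) + wdeg w (lead j l))%N.
Proof.
by move=> E; rewrite -!wdegU -!wdegD (route_monomial_step symT irrT acycT E).
Qed.

(** Each step of the route trades a diagonal variable for an edge variable and loses the cost of
    that edge. *)
Lemma wdeg_route_monomial k l :
  (wdeg w (lead k l) + dist T k l = n.-1 * max_weight n)%N.
Proof.
move: k l; apply: (route_ind symT irrT acycT) => [k|k l j kl kj E IH].
  rewrite (dist_refl hG hT) addn0 /lead route_monomial_refl // wdeg_sum.
  rewrite (eq_bigr (fun=> max_weight n)) => [|i _].
    by rewrite sum_nat_const cardC1 card_ord.
  rewrite wdegU -(combined_weight_var hG hT i i); have := edge_cost_eq0 G T i i.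
  by rewrite eqxx => /eqP ->; rewrite addn0.
rewrite (dist_step hG hT E); have := wdeg_route_step E.
have := combined_weight_var hG hT k j; have := combined_weight_var hG hT k k.
have /eqP -> : edge_cost G T k k == 0%N by rewrite edge_cost_eq0.
by rewrite -/w; lia.
Qed.

(* Sum d(s i, l) <= cost(s i, i) + d(i, l) over i <> k; as s is a bijection
   with s k = l, the distances cancel up to d(k, l). *)
Lemma dist_le_perm_cost (s : 'S_n) k l : s k = l ->
  (dist T k l <= \sum_(i | i != k) edge_cost G T i (s i))%N.
Proof.
move=> skl.
have S1 : (\sum_(i | i != k) dist T (s i) l <=
    \sum_(i | i != k) edge_cost G T i (s i) + \sum_(i | i != k) dist T i l)%N.
  rewrite -big_split /=; apply: leq_sum => i _.
  by rewrite (edge_cost_sym hG hT) (dist_triangle hG hT).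
have S2 : (\sum_i dist T (s i) l = \sum_i dist T i l)%N.
  by rewrite [RHS](reindex_inj (@perm_inj _ s)).
rewrite (bigD1 k) //= skl (dist_refl hG hT) add0n [in RHS](bigD1 k) //= in S2.
by rewrite S2 leq_add2r in S1.
Qed.

Lemma wdeg_cofactor_le k l m : m \in msupp (A k l) ->
  (wdeg w m <= wdeg w (lead k l))%N.
Proof.
case/cofactor_msupp=> s /dist_le_perm_cost; have := wdeg_perm_monomial s k.
by move=> + + ->; have := wdeg_route_monomial k l; lia.
Qed.

(** The weight of [lead k k] leaves no room for a positive edge cost, so only the identity
    permutation contributes. *)
Lemma cofactor_lead_refl k m : (wdeg w (lead k k) <= wdeg w m)%N ->
  (A k k)@_m = (m == lead k k)%:R.
Proof.
move=> le_m; rewrite cofactor_permE raddf_sum /= (bigD1 1%g) ?perm1 //=.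
rewrite odd_perm1 expr0 scale1r mcoeffX.
have -> : perm_monomial 1 k = lead k k.
  rewrite /lead route_monomial_refl //; apply: eq_bigr => i _.
  by rewrite perm1.
rewrite eq_sym big1 ?addr0 // => s /andP[/eqP sk s1].
rewrite mcoeffZ mcoeffX; case: eqP => [em|_]; last by rewrite mulr0.
case/eqP: s1; apply/permP=> i; rewrite perm1.
have [->//|ik] := eqVneq i k.
have := wdeg_perm_monomial s k; have := wdeg_route_monomial k k.
rewrite (dist_refl hG hT) em (bigD1 i) //= => e1 e2.
apply/esym/eqP; rewrite -(edge_cost_eq0 G T); apply/eqP; lia.
Qed.

Lemma xvar_mul_msupp i j p m : m \in msupp (xvar K i j * p) ->
  exists2 m', m' \in msupp p & m = (U_(var_index i j) + m')%MM.
Proof.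
rewrite mulrC (perm_mem (msuppMX _ _)) => /mapP[m' m'p ->].
by exists m'.
Qed.

Lemma mcoeff_xvarM i j p m :
  (xvar K i j * p)@_(U_(var_index i j) + m) = p@_m.
Proof. by rewrite /xvar mulrC mcoeffMX. Qed.

(** Induction along the route. In row relation [k], compare coefficients at [x_kk m] with [m] at
    least as heavy as [lead k l]: a detour over [i] off the route is strictly costlier, so its term
    is too light. Only [x_kk A_kl] and [x_kj A_jl] remain, whose coefficients are opposite. The
    leading coefficient is therefore a sign, nonzero in every characteristic. *)
Lemma cofactor_lead k l :
  (A k l)@_(lead k l) != 0 /\
  (forall m, m \in msupp (A k l) -> m != lead k l ->
     (wdeg w m < wdeg w (lead k l))%N).
Proof.
move: k l; apply: (route_ind symT irrT acycT) => [k|k l j kl kj E [IH1 IH2]].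
  split=> [|m mA mk]; first by rewrite cofactor_lead_refl // eqxx oner_neq0.
  rewrite ltnNge; apply: contraTN mA => /cofactor_lead_refl.
  by rewrite (negbTE mk) mcoeff_msupp => ->; rewrite eqxx.
have jk : j != k by rewrite eq_sym.
have step := route_monomial_step symT irrT acycT E.
have coefE m : (wdeg w (lead k l) <= wdeg w m)%N ->
    (A k l)@_m = - (xvar K k j * A j l)@_(U_(var_index k k) + m).
  move=> le_m; have other i : (i != k) && (i != j) ->
      (xvar K k i * A i l)@_(U_(var_index k k) + m) = 0.
    case/andP=> ik ij.
    apply/eqP; rewrite mcoeff_eq0; apply/negP=> /xvar_mul_msupp[m' m'A].
    move/(congr1 (wdeg w)); rewrite !wdegD !wdegU.
    have := wdeg_cofactor_le m'A.
    have := wdeg_route_monomial k l; have := wdeg_route_monomial i l.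
    have := combined_weight_var hG hT k i; have := combined_weight_var hG hT k k.
    have /eqP -> : edge_cost G T k k == 0%N by rewrite edge_cost_eq0.
    case: (dist_lt_detour hG hT kl ik) => [E'|]; last by rewrite -/w; lia.
    by move: E'; rewrite E => -[/esym/eqP]; rewrite (negbTE ij).
  have := congr1 (mcoeff (U_(var_index k k) + m)) (genX_cofactor_row k l).
  rewrite (negbTE kl) mulr0n mcoeff0 raddf_sum /= (bigD1 k) //= (bigD1 j) //=.
  have cancel3 (a a' b c : K) : a + (b + c) = 0 -> a = a' -> c = 0 -> a' = - b.
    by move=> + e1 e2; rewrite e1 e2 addr0 => /eqP; rewrite addr_eq0 => /eqP.
  by move/cancel3; apply; [apply: mcoeff_xvarM | apply: big1].
split=> [|m mA mk].
  by rewrite coefE // step oppr_eq0 mcoeff_xvarM.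
rewrite ltnNge; apply/negP=> le_m; move: mA.
rewrite mcoeff_msupp coefE // oppr_eq0 -mcoeff_msupp => /xvar_mul_msupp[m' m'A].
move=> em; have := congr1 (wdeg w) em; rewrite !wdegD !wdegU.
have := wdeg_route_step E.
case: (eqVneq m' (lead j l)) => [e|/(IH2 _ m'A)]; last first.
  by rewrite -/lead; lia.
by move: em mk; rewrite e -step => /addmI ->; rewrite eqxx.
Qed.

(** Both are the unique heaviest monomial of the same polynomial [A k l = A l k]. *)
Lemma route_monomialC k l : lead k l = lead l k.
Proof.
have [n1 d1] := cofactor_lead k l; have [n2 d2] := cofactor_lead l k.
apply/eqP; apply: contraT => ne.
rewrite cofactorC -mcoeff_msupp in n1; rewrite cofactorC -mcoeff_msupp in n2.
have := d1 _ n2; rewrite eq_sym => /(_ ne); have := d2 _ n1 ne; lia.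
Qed.

Lemma route_vertsC k l : route_verts T k l = route_verts T l k.
Proof.
apply/setP=> i; have := route_monomial_diag symT irrT acycT k l i.
rewrite -/lead route_monomialC route_monomial_diag //.
by case: (i \in route_verts T l k); case: (i \in route_verts T k l).
Qed.

(** Put [k'] and [l'] in the order in which the route meets them. The piece between them misses [k]
    unless it starts there and, read backwards, misses [l] unless it ends there. *)
Lemma route_verts_ends k l k' l' :
  k' \in route_verts T k l -> l' \in route_verts T k l ->
  k \in route_verts T k' l' -> l \in route_verts T k' l' ->
  k' = k /\ l' = l \/ k' = l /\ l' = k.
Proof.
have ordered a b : a \in route_verts T k l -> b \in route_verts T a l ->
    k \in route_verts T a b -> l \in route_verts T a b -> a = k /\ b = l.
  move=> ain; rewrite (route_vertsC a l) (route_vertsC a b) => bin kin lin.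
  have [_ Ha] := route_verts_suffix symT irrT acycT ain.
  have [sub Hb] := route_verts_suffix symT irrT acycT bin.
  split; apply/eqP; apply: contraT.
    by move/Ha; rewrite route_vertsC (subsetP sub _ kin).
  by move/Hb; rewrite lin.
move=> k'in l'in kin lin.
case: (route_verts_total symT irrT acycT k'in l'in) => [l'k'|k'l'].
  by left; apply: ordered.
rewrite route_vertsC in kin; rewrite route_vertsC in lin.
by right; have [-> ->] := ordered _ _ l'in k'l' kin lin.
Qed.

End LeadingTerms.

(** * Combinations of a family with distinct leading monomials *)

Section MonomialExtension.
Variables (K : fieldType) (N : nat) (u : 'X_{1..N} -> {mpoly K[N]}).
Implicit Types f g : {mpoly K[N]}.

(** The [K]-linear map that sends each monomial [m] to [u m]. *)
Definition mlinext g : {mpoly K[N]} := \sum_(m <- msupp g) g@_m *: u m.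

Lemma mlinextE g s : uniq s -> {subset msupp g <= s} ->
  mlinext g = \sum_(m <- s) g@_m *: u m.
Proof.
move=> us sub; rewrite [RHS](bigID (mem (msupp g))) /= [X in _ + X]big1 => [|m].
  rewrite addr0 -big_filter /mlinext; apply: perm_big; apply: uniq_perm.
  - exact: msupp_uniq.
  - exact: filter_uniq.
  - by move=> m; rewrite mem_filter; case: (boolP (m \in msupp g)) => [/sub ->|].
by move/memN_msupp_eq0 => ->; rewrite scale0r.
Qed.

Lemma mlinext0 : mlinext 0 = 0.
Proof. by rewrite /mlinext msupp0 big_nil. Qed.

Lemma mlinextD f g : mlinext (f + g) = mlinext f + mlinext g.
Proof.
pose s := undup (msupp f ++ msupp g).
rewrite !(@mlinextE _ s) ?undup_uniq // => [|m|m|m]; last first.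
- by rewrite mem_undup => /msuppD_le.
- by rewrite mem_undup mem_cat => ->.
- by rewrite mem_undup mem_cat orbC => ->.
by rewrite -big_split; apply: eq_bigr => m _; rewrite mcoeffD scalerDl.
Qed.

Lemma mlinextZ c g : mlinext (c *: g) = c *: mlinext g.
Proof.
rewrite (mlinextE (msupp_uniq g) (@msuppZ_le _ _ c g)) scaler_sumr.
by apply: eq_bigr => m _; rewrite mcoeffZ scalerA.
Qed.

Lemma mlinextX m : mlinext 'X_[m] = u m.
Proof. by rewrite /mlinext msuppX big_seq1 mcoeffX eqxx scale1r. Qed.

Variable lt : rel 'X_{1..N}.
Hypotheses (lt_irr : irreflexive lt) (lt_trans : transitive lt)
  (lt_negtrans : forall b a c, lt a c -> lt a b || lt b c).

Lemma maximal_in (s : seq 'X_{1..N}) : s != [::] ->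
  exists2 m0, m0 \in s & {in s, forall m, ~~ lt m0 m}.
Proof.
elim: s => // a [|b s] IHs _.
  by exists a => [|m]; rewrite inE // => /eqP ->; rewrite lt_irr.
have [//|m0 m0s max0] := IHs.
have [la|nla] := boolP (lt m0 a).
  exists a => [|m]; first exact: mem_head.
  rewrite inE => /orP[/eqP ->|/max0]; first by rewrite lt_irr.
  by apply: contra; apply: lt_trans la.
exists m0 => [|m]; first by rewrite inE m0s orbT.
by rewrite inE => /orP[/eqP ->|/max0].
Qed.

(* Among the leading monomials m of the u m occurring in mlinext g, those that
   are maximal cannot be cancelled. *)
Lemma msupp_maximal_mlinext g m :
    {in msupp g, forall a, (u a)@_a = 1 /\
       {in msupp (u a), forall b, b = a \/ lt b a}} ->
  m \in msupp (mlinext g) -> {in msupp (mlinext g), forall b, ~~ lt m b} ->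
  m \in msupp g.
Proof.
move=> lead_u mf mmax.
have [g0|g_n0] := eqVneq (msupp g) [::].
  by rewrite /mlinext g0 big_nil msupp0 in mf.
have [m0 m0g max0] := maximal_in g_n0.
(* Any other [u a] containing [b] would have [b] below [a]; by negative transitivity [b] is below
   [m0] or [m0] below [a], and both are excluded. *)
have top b : ~~ lt b m0 -> (mlinext g)@_b = g@_b.
  move=> nlt; rewrite /mlinext raddf_sum /=.
  have other a : a \in msupp g -> a != b -> (u a)@_b = 0.
    move=> ag ab; apply/eqP; rewrite mcoeff_eq0; apply/negP.
    case/(proj2 (lead_u a ag)) => [ba|ba]; first by rewrite ba eqxx in ab.
    by case/orP: (lt_negtrans m0 ba) => [|/negPn]; rewrite ?(negbTE nlt) ?max0.
  have [bg|bg] := boolP (b \in msupp g).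
    rewrite (bigD1_seq b) ?msupp_uniq //= mcoeffZ (proj1 (lead_u b bg)) mulr1.
    rewrite big_seq_cond big1 ?addr0 // => a /andP[ag ab].
    by rewrite mcoeffZ other ?mulr0.
  rewrite (memN_msupp_eq0 bg) big_seq big1 // => a ag.
  by rewrite mcoeffZ other ?mulr0 //; apply: contraNneq bg => <-.
(* So [m0] survives in [mlinext g]; hence the maximal [m] is not below [m0], and [top] applies to
   it. *)
have m0f : m0 \in msupp (mlinext g).
  by rewrite mcoeff_msupp top ?lt_irr // -mcoeff_msupp.
by rewrite mcoeff_msupp -top ?mmax // -mcoeff_msupp.
Qed.

End MonomialExtension.

(** * The weight order as a strict weak order *)

Section WeightOrder.
Variables (N : nat) (w1 w2 w3 : 'I_N -> nat).
Local Notation lt := (weight_lt w1 w2 w3).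

Lemma weight_lt_irr : irreflexive lt.
Proof. by move=> m; rewrite /weight_lt !ltnn !andbF. Qed.

Lemma weight_lt_trans : transitive lt.
Proof. by move=> b a c; rewrite /weight_lt; lia. Qed.

(** Incomparable monomials are those with the same three degrees, so incomparability is
    transitive. *)
Lemma weight_lt_negtrans b a c : lt a c -> lt a b || lt b c.
Proof. by rewrite /weight_lt; lia. Qed.

Lemma weight_ltD2l m a b : lt (m + a)%MM (m + b)%MM = lt a b.
Proof. by rewrite /weight_lt !wdegD !ltn_add2l !eqn_add2l. Qed.

End WeightOrder.

(** If [x' < x], then [B * x] is at least [B * x' + B], which exceeds the right-hand side. *)
Lemma lex_digit B x y x' y' : (y' < B)%N ->
  (B * x + y < B * x' + y')%N -> (x < x')%N \/ x = x' /\ (y < y')%N.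
Proof.
move=> hy'; case: (ltngtP x x') => [|xx'|->]; [by left| |].
  by have := leq_mul (leqnn B) xx'; rewrite mulnS; lia.
by rewrite ltn_add2l; right.
Qed.

(** * From the combined weight back to the weight order *)

Section ForestOrder.
Variables (n : nat) (G T : rel 'I_n).

Lemma graph_weight_le2 (H : rel 'I_n) v : (graph_weight H v <= 2)%N.
Proof. by rewrite /graph_weight; case: ifP. Qed.

Lemma wdeg_combined m : wdeg (combined_weight G T) m =
  (base n ^ 2 * wdeg (graph_weight G) m + base n * wdeg (graph_weight T) m +
   wdeg (@diag_weight n) m)%N.
Proof.
rewrite /wdeg !big_distrr -!big_split /=; apply: eq_bigr => v _.
by rewrite /combined_weight; move: (base n) => B; rewrite !mulnDl !mulnA.
Qed.

(** For monomials of degree at most [n] the three weighted degrees are below [base n], hence digits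
    of the combined degree. *)
Lemma forest_lt_combined a b : (mdeg a <= n)%N -> (mdeg b <= n)%N ->
  (wdeg (combined_weight G T) a < wdeg (combined_weight G T) b)%N ->
  forest_lt T G a b.
Proof.
have bound (H : rel 'I_n) m :
    (mdeg m <= n)%N -> (wdeg (graph_weight H) m < base n)%N.
  by move=> mn; have := wdeg_le m (@graph_weight_le2 H); rewrite /base; lia.
move=> an bn; rewrite !wdeg_combined /forest_lt /weight_lt /diag_weight.
move: (bound G _ bn) (bound T _ bn) (bound (fun _ _ => false) _ bn).
move: (wdeg _ a) (wdeg _ a) (wdeg _ a) (wdeg _ b) (wdeg _ b) (wdeg _ b).
move: (base n) => B z y x z' y' x' _ hy' hz'.
(* Horner form [B * (B * x + y) + z], so that the digits are peeled off one at a time from the low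
   end. *)
rewrite -mulnn -!mulnA -!mulnDr.
case/(lex_digit hz') => [|[e lz]].
  case/(lex_digit hy') => [->//|[-> ->]].
  by rewrite eqxx !orbT.
case: (ltngtP x x') => [//|xx'|xx'] /=.
  by have := leq_mul (leqnn B) xx'; rewrite mulnS; lia.
have -> : y = y' by move: e; rewrite xx'; lia.
by rewrite eqxx lz orbT.
Qed.

End ForestOrder.

(** * Propagation along connected syzygies *)

(* The binomial syzygies between the monomials lead k l lift to the row
   relations X adj(X) = det(X). As they connect any two generators dividing a
   given monomial M, all multiples of generators with leading monomial M agree
   up to scalars modulo multiples with smaller leading monomials. *)
Section ConnectedSyzygies.
Variables (K : fieldType) (n : nat) (w : 'I_(nvars n) -> nat).
Variables (A : 'I_n -> 'I_n -> {mpoly K[nvars n]}) (D : {mpoly K[nvars n]}).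
Variables (lead : 'I_n -> 'I_n -> 'X_{1..nvars n}).
Variables (V : 'I_n -> 'I_n -> {set 'I_n}).
Implicit Types (i j k l : 'I_n) (m M : 'X_{1..nvars n}).

Hypothesis AC : forall k l, A k l = A l k.
Hypothesis leadC : forall k l, lead k l = lead l k.
Hypothesis VC : forall k l, V k l = V l k.
Hypothesis row_relation :
  forall k l, \sum_j xvar K k j * A j l = D *+ (k == l).
Hypothesis lead_diag : forall k l i, lead k l (var_index i i) = (i \notin V k l).
Hypothesis mem_V : forall k l, k \in V k l.
Hypothesis V_refl : forall k, V k k = [set k].
Hypothesis V_ends : forall k l k' l', k' \in V k l -> l' \in V k l ->
  k \in V k' l' -> l \in V k' l' -> k' = k /\ l' = l \/ k' = l /\ l' = k.
Hypothesis lead_refl_step : forall k i,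
  (U_(var_index k k) + lead k k = U_(var_index i i) + lead i i)%MM.
Hypothesis lead_refl_lt : forall k i, i != k ->
  (wdeg w (U_(var_index k i) + lead i k) <
   wdeg w (U_(var_index k k) + lead k k))%N.
Hypothesis lead_step : forall k l, k != l -> exists j,
  [/\ j != k, V j l \proper V k l,
      (U_(var_index k k) + lead k l = U_(var_index k j) + lead j l)%MM &
      forall i, i != k -> i != j ->
        (wdeg w (U_(var_index k i) + lead i l) <
         wdeg w (U_(var_index k k) + lead k l))%N].

(** [S] stands for the span of a chosen family; [S_some] provides one member for each monomial that
    some [lead k l] divides. *)
Variable S : {mpoly K[nvars n]} -> Prop.
Hypothesis S0 : S 0.
Hypothesis SD : forall f g, S f -> S g -> S (f + g).
Hypothesis SZ : forall c f, S f -> S (c *: f).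

Let E M k l := S ('X_[M - lead k l] * A k l).

Hypothesis S_some : forall k l M, (lead k l <= M)%MM ->
  exists k' l', (lead k' l' <= M)%MM /\ E M k' l'.

Let SN f : S f -> S (- f).
Proof. by rewrite -scaleN1r; apply: SZ. Qed.

Let S_addr f g : S g -> S (f + g) <-> S f.
Proof.
move=> Sg; split=> [Sfg|Sf]; last exact: SD.
by rewrite -(addrK g f); apply: SD => //; apply: SN.
Qed.

Let S_sum (I : finType) (Q : pred I) (F : I -> {mpoly K[nvars n]}) :
  (forall x, Q x -> S (F x)) -> S (\sum_(x | Q x) F x).
Proof. by move=> SF; apply: (big_ind S). Qed.

(** As [k] is on the route, [x_kk] does not occur in [lead k l], so a factor [x_kk] of [M] is left
    over. *)
Let diag_le M k l : (lead k l <= M)%MM -> M (var_index k k) != 0%N ->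
  (U_(var_index k k) + lead k l <= M)%MM.
Proof.
move=> /mnm_lepP le_M Mk; apply/mnm_lepP=> v; rewrite mnmDE mnm1E.
have [<-|_] := eqVneq (var_index k k) v; last by rewrite add0n.
by rewrite lead_diag mem_V lt0n.
Qed.

Let row_term M k j l m : (m <= M)%MM -> m = (U_(var_index k j) + lead j l)%MM ->
  'X_[M - m] * (xvar K k j * A j l) = 'X_[M - lead j l] * A j l.
Proof.
move=> le_M em; rewrite mulrA -mpolyXD; congr ('X_[_] * _).
apply/mnmP=> v; rewrite mnmDE !mnmBE; have /mnm_lepP/(_ v) := le_M.
by rewrite em mnmDE; lia.
Qed.

Section Step.
Variable M : 'X_{1..nvars n}.
Hypothesis IH : forall M' k l,
  (wdeg w M' < wdeg w M)%N -> (lead k l <= M')%MM -> E M' k l.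

(** The product is a shifted cofactor whose leading monomial is lighter than [M], so the induction
    hypothesis covers it. *)
Let lower_term k l i m : (m <= M)%MM ->
  (wdeg w (U_(var_index k i) + lead i l) < wdeg w m)%N ->
  S ('X_[M - m] * (xvar K k i * A i l)).
Proof.
move=> le_M lt_m; rewrite mulrA -mpolyXD.
have := IH (M' := (M - m + U_(var_index k i) + lead i l)%MM) (k := i) (l := l).
rewrite /E addmK; apply; last exact: lem_addl.
have -> : wdeg w M = (wdeg w (M - m)%MM + wdeg w m)%N by rewrite -wdegD submK.
by rewrite -addmA wdegD ltn_add2l.
Qed.

(** The row relation, shifted to [M], has exactly two terms at [M]; all others are lighter and lie
    in [S]. *)
Let E_step k l : k != l -> (U_(var_index k k) + lead k l <= M)%MM ->
  exists j, [/\ (lead j l <= M)%MM, V j l \proper V k l & E M k l <-> E M j l].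
Proof.
move=> kl le_M; have [j [jk sub step small]] := lead_step kl.
have le_M' : (U_(var_index k j) + lead j l <= M)%MM by rewrite -step.
exists j; split=> //; first by apply: lepm_trans le_M'; apply: lem_addl.
set m := (U_(var_index k k) + lead k l)%MM in le_M step small.
have := congr1 ( *%R 'X_[M - m]) (row_relation k l).
rewrite (negbTE kl) mulr0n mulr0 (bigD1 k) //= (bigD1 j) //= !mulrDr mulr_sumr.
rewrite (row_term le_M (erefl _)) (row_term le_M step).
set r := \sum_(i | _) _; set a := _ * A k l; set b := _ * A j l => abr.
have Sr : S r.
  by apply: S_sum => i /andP[ik ij]; apply: lower_term => //; apply: small.
have ea : a = - (b + r) by apply/eqP; rewrite -addr_eq0 abr.
have eb : b = - (a + r) by apply/eqP; rewrite -addr_eq0 addrCA abr.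
rewrite /E -/a -/b; split=> Sab; first by rewrite eb; apply/SN/SD.
by rewrite ea; apply/SN/SD.
Qed.

(** All products [x_jj lead j j] coincide. The diagonal row relations therefore compare each
    [E M j j] with the same multiple of [D]. *)
Let E_refl k i : (U_(var_index k k) + lead k k <= M)%MM -> E M k k <-> E M i i.
Proof.
move=> le_M; suff det j :
    E M j j <-> S ('X_[M - (U_(var_index k k) + lead k k)] * D).
  by rewrite !det.
have le_Mj := le_M; rewrite (lead_refl_step k j) in le_Mj *.
have := congr1 ( *%R 'X_[M - (U_(var_index j j) + lead j j)]) (row_relation j j).
rewrite eqxx mulr1n => <-; rewrite (bigD1 j) //= mulrDr mulr_sumr.
rewrite (row_term le_Mj (erefl _)) S_addr //.
by apply: S_sum => i' ij; apply: lower_term => //; apply: lead_refl_lt.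
Qed.

(** Move an end inwards as long as its diagonal variable divides [M]; the vertex set shrinks
    strictly each time. *)
Let E_final k l : (lead k l <= M)%MM -> exists k' l',
  [/\ (lead k' l' <= M)%MM, E M k l <-> E M k' l' &
      k' = l' \/
      k' != l' /\ M (var_index k' k') = 0%N /\ M (var_index l' l') = 0%N].
Proof.
have [c] := ubnP #|V k l|; elim: c k l => // c IHc k l; rewrite ltnS => cV le_M.
have [e|kl] := eqVneq k l; first by exists k, l; split; [|split|left].
have [Mk|Mk] := eqVneq (M (var_index k k)) 0%N.
  have [Ml|Ml] := eqVneq (M (var_index l l)) 0%N.
    by exists k, l; split; [|split|right].
  (* The end [l] is moved by the same step after exchanging the two indices. *)
  rewrite leadC in le_M; rewrite eq_sym in kl.
  have [j [le_j /proper_card sub Ej]] := E_step kl (diag_le le_M Ml).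
  have [|k' [l' [le' E' fin]]] := IHc j k _ le_j.
    by apply: leq_trans cV; rewrite (VC k).
  by exists k', l'; split=> //; rewrite {1}/E AC leadC -/(E M l k) Ej.
have [j [le_j /proper_card sub Ej]] := E_step kl (diag_le le_M Mk).
have [|k' [l' [le' E' fin]]] := IHc j l _ le_j; first exact: leq_trans cV.
by exists k', l'; split=> //; rewrite Ej.
Qed.

Let zero_in_V k l i : (lead k l <= M)%MM -> M (var_index i i) = 0%N -> i \in V k l.
Proof.
move/mnm_lepP/(_ (var_index i i)); rewrite lead_diag => + Mi; rewrite Mi.
by case: (i \in V k l).
Qed.

(** Compare final positions: every vertex whose diagonal variable is absent from [M] lies on both
    routes. Two nontrivial routes then contain each other's ends and agree up to reversal; a
    one-vertex route cannot contain two distinct ends; two one-vertex routes are related by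
    [E_refl]. *)
Let E_equiv k l k' l' : (lead k l <= M)%MM -> (lead k' l' <= M)%MM ->
  E M k l <-> E M k' l'.
Proof.
move=> /E_final[a [b [le_ab -> fin]]] /E_final[a' [b' [le_ab' -> fin']]].
have diag c d d' : (lead c c <= M)%MM -> (lead d d' <= M)%MM -> d != d' ->
    M (var_index d d) = 0%N -> M (var_index d' d') = 0%N -> False.
  move=> le_c le_d dd' Md Md'; move: dd'.
  have := zero_in_V le_c Md; have := zero_in_V le_c Md'.
  by rewrite V_refl !inE => /eqP -> /eqP ->; rewrite eqxx.
case: fin fin' => [e|[ab [Ma Mb]]] [e'|[ab' [Ma' Mb']]].
- rewrite -e -e' in le_ab le_ab' *.
  have [<-//|aa'] := eqVneq a a'.
  apply: E_refl; apply: diag_le => //; apply/eqP=> Ma.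
  by have := zero_in_V le_ab' Ma; rewrite V_refl inE (negbTE aa').
- by case: (diag a a' b'); rewrite // {2}e.
- by case: (diag a' a b); rewrite // {2}e'.
have [] := @V_ends a b a' b'; try exact: zero_in_V.
  by case=> -> ->.
by case=> -> ->; rewrite {2}/E AC leadC.
Qed.

Lemma shifted_generator_in k l : (lead k l <= M)%MM -> E M k l.
Proof.
by move=> le_M; have [k' [l' [le' Ekl]]] := S_some le_M; rewrite (E_equiv le_M le').
Qed.

End Step.

Lemma shifted_generators_span k l M : (lead k l <= M)%MM ->
  S ('X_[M - lead k l] * A k l).
Proof.
have [c] := ubnP (wdeg w M); elim: c k l M => // c IHc k l M; rewrite ltnS => cM.
apply: shifted_generator_in => M' k' l' lt_M; apply: IHc; exact: leq_trans cM.
Qed.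

End ConnectedSyzygies.

(** * Ideals given by generators *)

Section IdealGen.
Variable R : comNzRingType.
Implicit Types (S : R -> Prop) (f g a : R).

Lemma ideal_gen0 S : ideal_gen S 0.
Proof. by exists [::]; split=> //; rewrite big_nil. Qed.

Lemma ideal_genD S f g : ideal_gen S f -> ideal_gen S g -> ideal_gen S (f + g).
Proof.
move=> [s [Ss ->]] [t [St ->]]; exists (s ++ t); rewrite big_cat; split=> // c.
by rewrite mem_cat => /orP[/Ss|/St].
Qed.

Lemma ideal_genM S a f : ideal_gen S f -> ideal_gen S (a * f).
Proof.
move=> [s [Ss ->]]; exists [seq (a * c.1, c.2) | c <- s].
split=> [_ /mapP[c cs ->]|]; first exact: (Ss c cs).
by rewrite big_map mulr_sumr; apply: eq_bigr => c _; rewrite mulrA.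
Qed.

Lemma ideal_gen_mem S f : S f -> ideal_gen S f.
Proof.
move=> Sf; exists [:: (1, f)]; split=> [c|]; last by rewrite big_seq1 mul1r.
by rewrite inE => /eqP ->.
Qed.

Lemma ideal_gen_sub S S' : (forall f, S f -> ideal_gen S' f) ->
  forall f, ideal_gen S f -> ideal_gen S' f.
Proof.
move=> sub f [s [Ss ->]]; rewrite big_seq.
apply: (big_ind (ideal_gen S')); [exact: ideal_gen0|exact: ideal_genD|].
by move=> c cs; apply/ideal_genM/sub/Ss.
Qed.

End IdealGen.

Lemma initial_form_lead (K : fieldType) N (lt : rel 'X_{1..N})
    (f : {mpoly K[N]}) m0 :
  irreflexive lt -> transitive lt -> m0 \in msupp f ->
  {in msupp f, forall m, m = m0 \/ lt m m0} ->
  initial_form lt f = f@_m0 *: 'X_[m0].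
Proof.
move=> lt_irr lt_trans m0f top; rewrite /initial_form -big_filter.
rewrite (perm_big [:: m0]) ?big_seq1 //; apply: uniq_perm => //.
  by rewrite filter_uniq.
move=> m; rewrite mem_filter inE; apply/andP/eqP => [[/allP mmax mf]|->].
  by case: (top m mf) => // lt_m; have := mmax _ m0f; rewrite lt_m.
split=> //; apply/allP=> m' /top[->|lt_m']; first by rewrite lt_irr.
by apply: contraFN (lt_irr m0) => lt_m0; apply: lt_trans lt_m'.
Qed.

Lemma mcoeff_mulX_sub (K : fieldType) N (p : {mpoly K[N]}) m M :
  (m <= M)%MM -> ('X_[M - m] * p)@_M = p@_m.
Proof.
move=> le_M; have -> : ('X_[M - m] * p)@_M = ('X_[M - m] * p)@_(M - m + m).
  by rewrite submK.
by rewrite mulrC mcoeffMX.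
Qed.

(** * The initial ideal of the ideal of minors *)

Section InitialIdeal.
Variables (K : fieldType) (n : nat) (G T : rel 'I_n).
Hypotheses (hG : simple_graph G) (hT : spanning_forest T G).
Implicit Types i j k l : 'I_n.

Let symT := spanning_forest_sym hT.
Let irrT := spanning_forest_irr hG hT.
Let acycT := spanning_forest_acyclic hG hT.
Local Notation w := (combined_weight G T).
Local Notation lead := (route_monomial T).
Local Notation A := (cofactor (genX K n)).
Local Notation lt := (forest_lt T G).

Lemma minor_cofactor k l : minor K k l = (-1) ^+ (k + l) *: A k l.
Proof.
rewrite /cofactor -mul_mpolyC rmorphXn /= mpolyCN mpolyC1.
by rewrite mulrA -expr2 sqrr_sign mul1r.
Qed.

Lemma cofactor_lead_lt k l m : m \in msupp (A k l) -> m = lead k l \/ lt m (lead k l).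
Proof.
move=> mA; have [lead_n0 low] := cofactor_lead K hG hT k l.
have [->|ne] := eqVneq m (lead k l); first by left.
right; apply: forest_lt_combined (low m mA ne).
  by rewrite (mdeg_cofactor mA) leq_pred.
by rewrite -mcoeff_msupp in lead_n0; rewrite (mdeg_cofactor lead_n0) leq_pred.
Qed.

Lemma initial_form_minor k l :
  exists2 c, c != 0 & initial_form lt (minor K k l) = c *: 'X_[lead k l].
Proof.
have [lead_n0 _] := cofactor_lead K hG hT k l.
have c_n0 : (minor K k l)@_(lead k l) != 0.
  by rewrite minor_cofactor mcoeffZ mulf_neq0 ?signr_eq0.
exists (minor K k l)@_(lead k l) => //; apply: initial_form_lead.
- exact: weight_lt_irr.
- exact: weight_lt_trans.
- by rewrite mcoeff_msupp.
by move=> m; rewrite minor_cofactor => /msuppZ_le/cofactor_lead_lt.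
Qed.

Lemma minor_neq0 k l : minor K k l != 0.
Proof.
have [c c_n0] := initial_form_minor k l; apply: contra_eqN => /eqP ->.
rewrite /initial_form msupp0 big_nil eq_sym; apply/eqP.
move/(congr1 (mcoeff (lead k l))); rewrite mcoeff0 mcoeffZ mcoeffX eqxx mulr1.
by move/eqP; rewrite (negbTE c_n0).
Qed.

(** One arbitrarily chosen multiple of a cofactor for each monomial, scaled to leading coefficient
    1. The value 0 is a default where no [lead k l] divides [M]. *)
Definition lead_cofactor (M : 'X_{1..nvars n}) : {mpoly K[nvars n]} :=
  if [pick kl : 'I_n * 'I_n | (lead kl.1 kl.2 <= M)%MM] is Some kl then
    ((A kl.1 kl.2)@_(lead kl.1 kl.2))^-1 *:
      ('X_[M - lead kl.1 kl.2] * A kl.1 kl.2)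
  else 0.

Lemma lead_cofactorE k l M : (lead k l <= M)%MM -> exists k' l',
  (lead k' l' <= M)%MM /\
  lead_cofactor M =
    ((A k' l')@_(lead k' l'))^-1 *: ('X_[M - lead k' l'] * A k' l').
Proof.
move=> le_M; rewrite /lead_cofactor; case: pickP => [[k' l'] le'|].
  by exists k', l'.
by move/(_ (k, l)); rewrite /= le_M.
Qed.

Lemma lead_cofactor_lead k l M : (lead k l <= M)%MM ->
  (lead_cofactor M)@_M = 1 /\
  {in msupp (lead_cofactor M), forall m, m = M \/ lt m M}.
Proof.
case/lead_cofactorE=> k' [l' [le_M ->]].
have [lead_n0 _] := cofactor_lead K hG hT k' l'.
rewrite mcoeffZ mcoeff_mulX_sub // mulVf //; split=> // m.
move/msuppZ_le; rewrite mulrC (perm_mem (msuppMX _ _)).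
case/mapP=> m' /cofactor_lead_lt lt_m' ->.
case: lt_m' => [->|lt_m']; [left; exact: submK|right].
have : lt (M - lead k' l' + m')%MM (M - lead k' l' + lead k' l')%MM.
  by rewrite /forest_lt weight_ltD2l.
by rewrite submK.
Qed.

(** The support condition keeps the default value 0 out, so every family member used really has its
    index as leading monomial. *)
Let spanned (f : {mpoly K[nvars n]}) : Prop := exists2 g,
  {in msupp g, forall M, exists k l, (lead k l <= M)%MM} &
  f = mlinext lead_cofactor g.

Let spanned0 : spanned 0.
Proof. by exists 0; rewrite ?mlinext0 // => M; rewrite msupp0. Qed.

Let spannedD f g : spanned f -> spanned g -> spanned (f + g).
Proof.
move=> [p pl ->] [q ql ->]; exists (p + q); last by rewrite mlinextD.
by move=> M /msuppD_le; rewrite mem_cat => /orP[/pl|/ql].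
Qed.

Let spannedZ c f : spanned f -> spanned (c *: f).
Proof.
move=> [p pl ->]; exists (c *: p); last by rewrite mlinextZ.
by move=> M /msuppZ_le/pl.
Qed.

Let spanned_some k l M : (lead k l <= M)%MM -> exists k' l',
  (lead k' l' <= M)%MM /\ spanned ('X_[M - lead k' l'] * A k' l').
Proof.
move=> le_M; have [k' [l' [le' E]]] := lead_cofactorE le_M.
exists k', l'; split=> //; have [lead_n0 _] := cofactor_lead K hG hT k' l'.
exists ((A k' l')@_(lead k' l') *: 'X_[M]).
  by move=> M' /msuppZ_le; rewrite msuppX inE => /eqP ->; exists k, l.
by rewrite mlinextZ mlinextX E scalerA divff // scale1r.
Qed.

Let wdeg_step a b l :
  (wdeg w (U_(var_index a b) + lead b l) + (edge_cost G T a b + dist T b l) =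
   n * max_weight n)%N.
Proof.
rewrite wdegD wdegU addnACA combined_weight_var // wdeg_route_monomial //.
by case: n a => [[]|n'] // _; rewrite mulSn.
Qed.

Let spanned_all k l M : (lead k l <= M)%MM -> spanned ('X_[M - lead k l] * A k l).
Proof.
have cost0 a : edge_cost G T a a = 0%N by apply/eqP; rewrite edge_cost_eq0.
(* The product [x_aa lead a a] is the whole diagonal, whatever [a] is. *)
have full a : (U_(var_index a a) + lead a a = \sum_i U_(var_index i i))%MM.
  by rewrite route_monomial_refl // [RHS](bigD1 a).
apply: (@shifted_generators_span K n w A (\det (genX K n)) lead (route_verts T)).
- exact: cofactorC.
- exact: (route_monomialC K hG hT).
- exact: (route_vertsC K hG hT).
- exact: genX_cofactor_row.
- exact: route_monomial_diag.
- by move=> a b; rewrite mem_route_verts.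
- exact: route_verts_refl.
- exact: (route_verts_ends K hG hT).
- by move=> a b; rewrite !full.
- move=> a b ba; have := wdeg_step a b a; have := wdeg_step a a a.
  have := edge_cost_eq0 G T a b; rewrite (eq_sym a) (negbTE ba) cost0.
  by rewrite (dist_refl hG hT); lia.
- move=> a b ab; have [j [aj E]] := route_step symT irrT acycT ab.
  have [VE aV] := route_verts_step symT irrT acycT E.
  exists j; split; first by rewrite eq_sym.
  + by rewrite VE; apply: properUr; rewrite sub1set.
  + exact: route_monomial_step E.
  move=> i ia ij; have := wdeg_step a i b; have := wdeg_step a a b.
  rewrite cost0; case: (dist_lt_detour hG hT ab ia) => [|]; last by lia.
  by rewrite E => -[/esym/eqP]; rewrite (negbTE ij).
- exact: spanned0.
- exact: spannedD.
- exact: spannedZ.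
- exact: spanned_some.
Qed.

Lemma minors_ideal_spanned f : minors_ideal f -> spanned f.
Proof.
case=> s [Ss ->]; rewrite big_seq; apply: (big_ind spanned) => // c /Ss[k [l ->]].
rewrite minor_cofactor -scalerAr; apply: spannedZ.
rewrite [c.1]mpolyE mulr_suml; apply: (big_ind spanned) => // m _.
rewrite -scalerAl; apply: spannedZ.
(* The multiple of [A k l] by the monomial [m] is the shift with leading monomial [m + lead k l]. *)
by have := spanned_all (lem_addl m (lead k l)); rewrite addmK.
Qed.

Lemma mpolyX_route k l : 'X_[lead k l] =
  (\prod_(i < n | i \notin k :: route T k l) xvar K i i) *
    path_monomial K k (route T k l).
Proof.
rewrite /route_monomial mpolyXD -mprodXE; congr (_ * _).
rewrite -mprodXE /path_monomial; move: (route T k l) => p.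
by elim: p k => [|x p IHp] y /=; rewrite ?big_nil // !big_cons IHp.
Qed.

(** The three kinds of generators match the three shapes of a route: empty, a jump between
    components, a path in [T]. *)
Lemma IT_generatorP (h : {mpoly K[nvars n]}) :
  IT_generator T h <-> exists k l, h = 'X_[lead k l].
Proof.
have disconnected k l : ~~ connect T k l -> 'X_[lead k l] =
    (\prod_(j < n | (j != k) && (j != l)) xvar K j j) * xvar K k l.
  move=> nc; rewrite mpolyX_route route_disconnected // /path_monomial /= big_seq1.
  by congr (_ * _); apply: eq_bigl => i; rewrite !inE negb_or.
have path_route k p : simple_path T k p -> route T k (last k p) = p.
  by case/and3P=> _ pp up; apply: route_tree => //; rewrite /tree_path pp up /=.
have simple_route k l : k != l -> connect T k l -> simple_path T k (route T k l).
  move=> kl /(route_connected)/and3P[pp up /eqP lp]; apply/and3P; split=> //.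
  by apply: contraNneq kl => p0; rewrite p0 /= in lp; rewrite lp.
split=> [[i|k l kl np|k p kp]|[k [l ->]]].
- exists i, i; rewrite mpolyX_route route_refl // /path_monomial big_nil mulr1.
  by apply: eq_bigl => j; rewrite inE.
- exists k, l; rewrite disconnected //; apply/negP=> c; apply: np.
  exists (route T k l); rewrite last_route; split=> //; apply: simple_route => //.
  by apply: contraTneq kl => ->; rewrite ltnn.
- by exists k, (last k p); rewrite mpolyX_route path_route.
have [<-|kl] := eqVneq k l.
  rewrite mpolyX_route route_refl // /path_monomial big_nil mulr1.
  rewrite (eq_bigl (fun j => j != k)) => [|j]; last by rewrite inE.
  exact: IT_diag.
have [c|nc] := boolP (connect T k l).
  by rewrite mpolyX_route; apply: IT_path; apply: simple_route.
have no_path a b : ~~ connect T a b ->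
    ~ exists p, simple_path T a p /\ last a p = b.
  move=> /negP nab [p [/and3P[_ pp _] lp]]; apply: nab.
  by apply/connectP; exists p.
case: (ltngtP k l) => [lt_kl|lt_lk|/val_inj e]; last by rewrite e eqxx in kl.
  by rewrite disconnected //; apply: IT_disconnected => //; apply: no_path.
(* Generators for disconnected pairs require [k < l]; the other order reduces to this by symmetry of
   [lead]. *)
have nc' : ~~ connect T l k by rewrite (sym_connect_sym symT).
rewrite (route_monomialC K hG hT) disconnected //.
by apply: IT_disconnected => //; apply: no_path.
Qed.

(** Each monomial of the initial form is maximal in a combination of the family, hence is the index
    of a family member, and some [lead k l] divides it. *)
Lemma initial_ideal_sub_IT (f : {mpoly K[nvars n]}) :
  initial_ideal lt (@minors_ideal K n) f -> IT T f.
Proof.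
apply: ideal_gen_sub => _ [p [/minors_ideal_spanned[g good ->] _ ->]].
rewrite /initial_form -big_filter big_seq.
apply: (big_ind (IT T)); [exact: ideal_gen0|exact: ideal_genD|move=> m].
rewrite mem_filter => /andP[/allP mmax mp].
have [|k [l le_m]] := good m.
  apply: msupp_maximal_mlinext mp mmax.
  - exact: weight_lt_irr.
  - exact: weight_lt_trans.
  - exact: weight_lt_negtrans.
  by move=> M /good[k [l le_M]]; apply: lead_cofactor_lead le_M.
rewrite -mul_mpolyC; apply: ideal_genM; rewrite -(submK le_m) mpolyXD.
by apply/ideal_genM/ideal_gen_mem/IT_generatorP; exists k, l.
Qed.

Lemma IT_sub_initial_minors (f : {mpoly K[nvars n]}) : IT T f ->
  ideal_gen (fun h => exists g, @standard_minor K n g /\ h = initial_form lt g) f.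
Proof.
apply: ideal_gen_sub => _ /IT_generatorP[k [l ->]].
(* Standard minors have [k <= l], and [lead] is symmetric. *)
wlog le_kl : k l / (k <= l)%N.
  by case: (leqP k l) => [|/ltnW]; [|rewrite (route_monomialC K hG hT)]; auto.
have [c c_n0 init] := initial_form_minor k l.
have -> : 'X_[lead k l] = c^-1%:MP * initial_form lt (minor K k l).
  by rewrite init mul_mpolyC scalerA mulVf // scale1r.
apply/ideal_genM/ideal_gen_mem; exists (minor K k l); split=> //.
by exists k, l.
Qed.

Lemma initial_minors_sub_initial_ideal f :
  ideal_gen (fun h => exists g, @standard_minor K n g /\ h = initial_form lt g) f ->
  initial_ideal lt (@minors_ideal K n) f.
Proof.
apply: ideal_gen_sub => _ [_ [[k [l [_ ->]]] ->]]; apply: ideal_gen_mem.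
exists (minor K k l); split=> //; last exact: minor_neq0.
by apply: ideal_gen_mem; exists k, l.
Qed.

End InitialIdeal.

Theorem corollary5 (K : fieldType) (n : nat) (hn : (2 <= n)%N)
  (G T : rel 'I_n) (hG : simple_graph G) (hT : spanning_forest T G) :
  groebner_basis (forest_lt T G) (@standard_minor K n) (@minors_ideal K n) /\
  (forall f : {mpoly K[nvars n]},
     initial_ideal (forest_lt T G) (@minors_ideal K n) f <-> IT T f).
Proof.
(* Three inclusions close a circle: initial forms of the minors, initial ideal, [IT T], and back to
   the initial forms. *)
split=> [|f].
  split=> [g [k [l [_ ->]]]|f]; first by apply: ideal_gen_mem; exists k, l.
  split; first exact: initial_minors_sub_initial_ideal.
  by move/(initial_ideal_sub_IT hG hT)/(IT_sub_initial_minors hG hT).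
split; first exact: initial_ideal_sub_IT.
by move/(IT_sub_initial_minors hG hT)/(initial_minors_sub_initial_ideal hG hT).
Qed.
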